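(* Let $\mathscr{H}$ be a Hilbert space, $\{P_j\}_{j\in\mathbb{N}_0}$ a family of selfadjoint projections in $\mathscr{H}$, $(\Omega,\mathscr{F},\mathbb{P})$ a probability space, and $\xi:\Omega\to\mathscr{B}(\mathscr{H})$ an operator-valued random variable with $$\mathbb{P}(\xi=P_j)=p_j,\quad j\in\mathbb{N}_0,\qquad p_j>0,\quad \sum_{j\in\mathbb{N}_0}p_j=1.$$ Suppose that there is a constant $C$, $0<C<1$, such that $$\mathbb{E}\left[\|\xi x\|^2\right]=\sum_{j\in\mathbb{N}_0}p_j\|P_jx\|^2\ge C\|x\|^2,\qquad\forall x\in\mathscr{H}.$$ Let $\{\xi_j\}_{j\ge1}$ be an i.i.d. sequence of operator-valued random variables with the same distribution as $\xi$, fix $\xi_0=P_0$, and set $$T_n=(1-\xi_n)(1-\xi_{n-1})\cdots(1-\xi_0),\qquad n\in\mathbb{N}_0.$$ Then, for all $x\in\mathscr{H}$, $$\lim_{n\to\infty}\mathbb{E}\left[\|T_nx\|^2\right]=0.$$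
   Context: $\mathbb{N}_0=\{0,1,2,\dots\}$. A selfadjoint projection is an operator $P$ with $P=P^*=P^2$; $1$ denotes the identity operator; $\mathscr{B}(\mathscr{H})$ is the algebra of bounded operators on $\mathscr{H}$. A map $\xi:\Omega\to\mathscr{B}(\mathscr{H})$ is an (operator-valued) random variable iff for all $x,y\in\mathscr{H}$ the function $\omega\mapsto\langle x,\xi(\omega)y\rangle$ is measurable. $\mathbb{E}(\cdot)=\int_\Omega(\cdot)\,d\mathbb{P}$. Two operator-valued random variables $\xi,\eta$ are independent iff for all $x,y\in\mathscr{H}$ the scalar random variables $\langle x,\xi y\rangle$ and $\langle x,\eta y\rangle$ are independent; i.i.d. means independent (as a family) and identically distributed. *)

(* Defs.v *)
From HB Require Import structures.
From mathcomp Require Import all_boot all_order all_algebra.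
From mathcomp Require Import sesquilinear complex.
From mathcomp Require Import all_classical all_reals all_analysis.
Import Order.TTheory GRing.Theory Num.Theory.
Import numFieldNormedType.Exports.

Set Implicit Arguments.
Unset Strict Implicit.
Unset Printing Implicit Defensive.

Local Open Scope classical_set_scope.
Local Open Scope ring_scope.

(* A Hilbert space may be real or complex; everything below is parametrised
   by this choice. *)
Variant scalar_kind := RealScalars | ComplexScalars.

Definition scalars (R : realType) (k : scalar_kind) : numFieldType :=
  match k with RealScalars => R | ComplexScalars => R[i] end.

Definition conj_scalar (R : realType) (k : scalar_kind) :
    scalars R k -> scalars R k :=
  match k with RealScalars => fun a => a | ComplexScalars => @conjc R end.

Definition re_scalar (R : realType) (k : scalar_kind) : scalars R k -> R :=
  match k with RealScalars => fun a => a | ComplexScalars => @complex.Re R end.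

(* MathComp's forms are linear in the first argument and conjugate-linear in
   the second. *)
Notation inner_product H := {dot H for @conj_scalar _ _}.

Section Operators.
Variables (R : realType) (k : scalar_kind).
Variable H : completeNormedModType (scalars R k).
Variable dot : inner_product H.

Definition induces_norm := forall x : H, `|x| ^+ 2 = dot x x.

(* The library norm takes its values in the scalar field (in R[i] when the
   space is complex); this is the same number in R. *)
Definition real_norm (x : H) : R := re_scalar `|x|.

Definition bounded_operator (A : H -> H) :=
  linear A /\ exists M : scalars R k, forall x, `|A x| <= M * `|x|.

Definition is_adjoint (A B : H -> H) := forall x y, dot (A x) y = dot x (B y).

Definition selfadjoint_projection (A : H -> H) :=
  [/\ bounded_operator A, is_adjoint A A & A \o A = A].

(* residual xi n = (1 - xi_n) (1 - xi_(n-1)) ... (1 - xi_0) *)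
Fixpoint residual (xi : nat -> H -> H) (n : nat) : H -> H :=
  match n with
  | 0%N => fun x => x - xi 0%N x
  | m.+1 => (fun x => x - xi n x) \o residual xi m
  end.

Section Random.
Context (d : measure_display) (Omega : measurableType d).
Variable Pr : probability Omega R.

Definition borel_scalars :=
  g_sigma_algebraType (@open (scalars R k)).

Definition operator_random_variable (xi : Omega -> H -> H) :=
  (forall w, bounded_operator (xi w)) /\
  forall x y, measurable_fun [set: Omega]
    (fun w => dot x (xi w y) : borel_scalars).

Definition mutually_independent (X : nat -> Omega -> scalars R k) :=
  forall (s : seq nat) (B : nat -> set borel_scalars),
    uniq s -> (forall i, measurable (B i)) ->
    Pr (\bigcap_(i in [set` s]) (X i @^-1` B i)) =
      (\prod_(i <- s) Pr (X i @^-1` B i))%E.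

Definition operators_independent (xi : nat -> Omega -> H -> H) :=
  forall x y, mutually_independent (fun n w => dot x (xi n w y)).

(* The distribution of xi is the sum over j of p_j times the Dirac mass at
   A_j. If some A_j coincide, the corresponding weights add up; for pairwise
   distinct A_j see discrete_distribution_inj. Weak measurability alone does
   not make {xi = A_j} an event when H is not separable. *)
Definition discrete_distribution (A : nat -> H -> H) (p : nat -> R)
    (xi : Omega -> H -> H) :=
  forall j, measurable (xi @^-1` [set A j]) /\
    Pr (xi @^-1` [set A j]) =
      (\sum_(0 <= i <oo | `[< A i = A j >]) (p i)%:E)%E.

Lemma discrete_distribution_inj (A : nat -> H -> H) (p : nat -> R)
    (xi : Omega -> H -> H) : injective A ->
  discrete_distribution A p xi <->
  forall j, measurable (xi @^-1` [set A j]) /\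
    Pr (xi @^-1` [set A j]) = (p j)%:E.
Proof.
move=> injA.
suff E j : (\sum_(0 <= i <oo | `[< A i = A j >]) (p i)%:E)%E = (p j)%:E.
  by split=> h j; have [? hj] := h j; split => //; rewrite hj E.
rewrite (eq_eseriesl (Q := pred1 j)); last first.
  by move=> i; apply/asboolP/eqP => [/injA|->].
apply: cvg_lim => //; apply: cvg_near_cst; near=> n.
rewrite big_mkord (big_pred1 (Ordinal (_ : j < n)%N)) //.
by near: n; exact: nbhs_infty_gt.
Unshelve. all: by end_near. Qed.

End Random.
End Operators.

(* Main.v *)
Require Import Defs.
From HB Require Import structures.
From mathcomp Require Import all_boot all_order all_algebra.
From mathcomp Require Import sesquilinear complex.
From mathcomp Require Import all_classical all_reals all_analysis.
From mathcomp Require Import measurable_realfun lra.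
Import Order.TTheory GRing.Theory Num.Theory.
Import numFieldNormedType.Exports.

Local Open Scope classical_set_scope.
Local Open Scope ring_scope.

Set Implicit Arguments.
Unset Strict Implicit.
Unset Printing Implicit Defensive.

(** Write v_n for (1 - xi_n) ... (1 - xi_0) x. Since every P_j is an orthogonal
    projection, |v - P_j v|^2 = |v|^2 - |P_j v|^2; with q_j the probability of
    the value P_j, averaging over the distinct P_j and the lower bound C give
      sum_j q_j |v - P_j v|^2 <= (1 - C) |v|^2      for each fixed vector v.
    As xi_(n+1) is independent of v_n, this applies to the random vector v_n and
    E |v_n|^2 <= (1 - C)^n |x|^2, which tends to 0. Three points need care.

    Independence. Only the scalar sequences <x, xi_n y>, with the same x and y
    for all n, are assumed independent, whereas the argument above needs the
    joint law of the operators. Given finitely many of the P_j, finitely many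
    nonzero linear maps have a common vector outside their kernels
    ([common_nonzero]), hence some x and y separate these operators through
    <x, P_j y> ([separating_vectors]). The fibres of the scalar variables
    then exceed the events xi_n = P_j by at most the mass of the remaining
    operators; letting their number grow gives
      Pr (xi_1 = P_(s_1), ..., xi_m = P_(s_m)) <= q_(s_1) ... q_(s_m)
    when no value is listed under two indices, see [history_prob_le]. This one inequality is all that the estimate uses.

    Repetitions. The P_j need not be distinct, so that the values of xi_n are
    enumerated by the leading indices, those j for which P_j does not occur
    earlier; the mass of all indices of the same operator is moved to the
    leading one ([weight]).

    Measurability. When the space is not separable, |v_n|^2 need not be
    measurable, because outside a null set xi_n is an arbitrary operator. Its
    integral is bounded through a measurable function that dominates it almost
    surely: the sum, over all sequences s of indices, of the value of
    |v_n|^2 along s times the indicator of the event that s occurs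
    ([energy_majorant], [mean_energy_composed]). *)

(** * Discrete laws with repeated values *)

Section LeadingIndices.
Context (V : Type) (A : nat -> V).

Definition leading (j : nat) : Prop := forall i, (i < j)%N -> A i <> A j.

Lemma leading_exists i : exists2 j, leading j & A i = A j.
Proof.
have ex : exists j, `[< A i = A j >] by exists i; apply/asboolP.
exists (ex_minn ex); last by case: ex_minnP => j /asboolP.
case: ex_minnP => j /asboolP Aij minj l lj Alj.
by have := minj l; rewrite leqNgt lj Alj => /(_ (asboolT Aij)).
Qed.

Lemma leading_inj i j : leading i -> leading j -> A i = A j -> i = j.
Proof.
move=> li lj Aij; case: (ltngtP i j) => // [ij|ji].
  by case: (lj _ ij).
by case: (li _ ji).
Qed.

Definition weight (R : realType) (p : nat -> R) (j : nat) : \bar R :=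
  if `[< leading j >] then (\sum_(0 <= i <oo | `[< A i = A j >]) (p i)%:E)%E
  else 0%E.

(** Each index i has exactly one leading index with the same value, so that
    after exchanging the two sums p_i is counted once. *)
Lemma weight_sum (R : realType) (p : nat -> R) : (forall j, 0 <= p j) ->
  (\sum_(0 <= j <oo) weight p j = \sum_(0 <= i <oo) (p i)%:E)%E.
Proof.
move=> p0.
pose a j i : \bar R :=
  if `[< leading j >] && `[< A i = A j >] then (p i)%:E else 0%E.
have a0 j i : (0 <= a j i)%E by rewrite /a; case: ifP; rewrite ?lee_fin.
transitivity (\sum_(0 <= j <oo) \sum_(0 <= i <oo) a j i)%E.
  apply: eq_eseriesr => j _; rewrite /weight /a.
  case: asboolP => _ /=; last by rewrite eseries0.
  by rewrite eseries_mkcond.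
rewrite (nneseries_interchange xpredT xpredT a0).
apply: eq_eseriesr => i _; have [j lj Aij] := leading_exists i.
rewrite (@nneseriesD1 _ _ j)// eseries0 ?adde0; last first.
  move=> l _ /= lj'; rewrite /a; case: asboolP => //= ll.
  case: asboolP => // Ail; move: lj'; rewrite (leading_inj ll lj) ?eqxx//.
  by rewrite -Ail.
by rewrite /a !asboolT.
Qed.

End LeadingIndices.

Section Atoms.
Context (R : realType) (d : measure_display) (Omega : measurableType d).
Context (Pr : probability Omega R) (V : Type) (A : nat -> V) (p : nat -> R).

Definition atom (eta : Omega -> V) (j : nat) : set Omega :=
  [set w | leading A j /\ eta w = A j].

Hypothesis p_ge0 : forall j, 0 <= p j.
Hypothesis p_sum : (\sum_(0 <= j <oo) (p j)%:E = 1)%E.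

Variable eta : Omega -> V.
Hypothesis law : forall j, measurable (eta @^-1` [set A j]) /\
  Pr (eta @^-1` [set A j]) = (\sum_(0 <= i <oo | `[< A i = A j >]) (p i)%:E)%E.

Lemma atomE j :
  atom eta j = if `[< leading A j >] then eta @^-1` [set A j] else set0.
Proof.
by case: asboolP => lj; apply/seteqP; split=> w //= [].
Qed.

Lemma measurable_atom j : measurable (atom eta j).
Proof. by rewrite atomE; case: ifP => // _; have [] := law j. Qed.

Lemma atom_weight j : Pr (atom eta j) = weight A p j.
Proof.
rewrite atomE /weight; case: ifP => _; last exact: measure0.
by have [] := law j.
Qed.

Lemma trivIset_atom : trivIset setT (atom eta).
Proof.
by apply/trivIsetP => i j _ _ ij; apply/seteqP; split => // w [[li ei] [lj ej]];
  move: ij; rewrite (leading_inj li lj) ?eqxx// -ei.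
Qed.

(** The atoms are disjoint, and their weights already add up to 1. *)
Lemma atoms_ae : Pr (~` \bigcup_j atom eta j) = 0%E.
Proof.
rewrite probability_setC; last first.
  by apply: bigcup_measurable => j _; exact: measurable_atom.
rewrite measure_bigcup//; [|by move=> *; exact: measurable_atom|exact: trivIset_atom].
rewrite (_ : (\sum_(_ <oo | _) _ = 1)%E) ?subee//.
rewrite -p_sum -(weight_sum A p_ge0) (eq_eseriesl (Q := xpredT)); last first.
  by move=> i; rewrite in_setT.
by apply: eq_eseriesr => j _; exact: atom_weight.
Qed.

Lemma atom_fineK j : (fine (weight A p j))%:E = Pr (atom eta j).
Proof. by rewrite -atom_weight fineK// fin_num_measure//; exact: measurable_atom. Qed.

Lemma tail_atoms N : Pr (~` \big[setU/set0]_(k < N) atom eta k) =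
  (1 - \sum_(k < N) fine (weight A p k))%:E.
Proof.
rewrite probability_setC; last first.
  by apply: bigsetU_measurable => j _; exact: measurable_atom.
rewrite measure_bigsetU; [|by move=> *; exact: measurable_atom|exact: trivIset_atom].
rewrite EFinB -sumEFin; congr (_ - _)%E.
by apply: eq_bigr => k _; rewrite atom_fineK.
Qed.

(** A function X of eta, taking the value c_k on eta = A_k, may identify A_j
    with other values, but not with the first N ones: its fibre over c_j is then
    the event eta = A_j up to the event that eta avoids these N values. *)
Lemma label_fiber_le (S : Type) (X : Omega -> S) (c : nat -> S) (j N : nat) :
  measurable (X @^-1` [set c j]) ->
  (forall w k, eta w = A k -> X w = c k) ->
  (forall k, (k < N)%N -> c k = c j -> A k = A j) -> leading A j ->
  (Pr (X @^-1` [set c j]) <=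
    (fine (weight A p j) + (1 - \sum_(k < N) fine (weight A p k)))%:E)%E.
Proof.
move=> mX Xc cA lj.
have mU : measurable (~` \big[setU/set0]_(k < N) atom eta k).
  by apply: measurableC; apply: bigsetU_measurable => k _; exact: measurable_atom.
rewrite EFinD atom_fineK -tail_atoms.
apply: le_trans (measureU2 _ _ _) => //; last exact: measurable_atom.
apply: le_measure; rewrite ?inE//.
  by apply: measurableU => //; exact: measurable_atom.
move=> w /= Xw; have [|] := pselect ((\big[setU/set0]_(k < N) atom eta k) w).
  rewrite -bigcup_mkord => -[k /= kN [_ ek]]; left; split => //.
  by rewrite ek; apply: cA => //; rewrite -(Xc _ _ ek).
by right.
Qed.

End Atoms.

Lemma weight_partial_cvg (R : realType) (V : Type) (A : nat -> V)
    (p : nat -> R) : (forall j, 0 <= p j) ->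
  (\sum_(0 <= j <oo) (p j)%:E = 1)%E ->
  (\sum_(k < N) fine (weight A p k)) @[N --> \oo] --> (1 : R).
Proof.
move=> p0 psum.
have w0 j : (0 <= weight A p j)%E.
  by rewrite /weight; case: ifP => // _; apply: nneseries_ge0 => i _ _; rewrite lee_fin.
have w1 j : (weight A p j <= 1)%E.
  rewrite -psum -(weight_sum A p0) (@nneseriesD1 _ _ j)//= leeDl//.
  exact: nneseries_ge0.
have wf j : weight A p j \is a fin_num.
  by rewrite ge0_fin_numE// (le_lt_trans (w1 j))// ltry.
have sumE N : (\sum_(0 <= k < N) weight A p k)%E =
    (\sum_(k < N) fine (weight A p k))%:E.
  by rewrite big_mkord -sumEFin; apply: eq_bigr => k _; rewrite fineK.
have : (\sum_(0 <= k < N) weight A p k)%E @[N --> \oo] --> 1%E.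
  rewrite -[X in _ --> X]psum -(weight_sum A p0).
  by apply: is_cvg_nneseries => k _ _; exact: w0.
by under eq_cvg do rewrite sumE; exact: fine_cvg.
Qed.

(** * Separating finitely many operators by one matrix coefficient *)

(** A vector space over an infinite field is not a finite union of proper
    subspaces. In the inductive step, on the line v + n z each map whose kernel
    misses v or z vanishes for at most one n, hence for no large n. *)
Lemma common_nonzero (K : numFieldType) (V W : lmodType K) (I : eqType)
    (s : seq I) (L : I -> V -> W) :
  (forall i, i \in s -> linear (L i)) ->
  (forall i, i \in s -> exists v, L i v <> 0) ->
  exists v, forall i, i \in s -> L i v <> 0.
Proof.
elim: s => [|i0 s IH] lin nz; first by exists 0.
have [i si|i si|v vP] := IH; first by apply: lin; rewrite in_cons si orbT.
  by apply: nz; rewrite in_cons si orbT.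
have [z z0] := nz i0 (mem_head _ _).
(* v avoids the kernels indexed by s, and z avoids the kernel of L i0 *)
have affine i n : i \in i0 :: s -> L i (n%:R *: z + v) = n%:R *: L i z + L i v.
  by move=> si; rewrite (lin _ si).
have line_nonzero i : i \in i0 :: s -> L i z <> 0 \/ L i v <> 0 ->
    \forall n \near \oo, L i (n%:R *: z + v) <> 0.
  move=> si zv.
  have [[n1 e1]|bad] := pselect (exists n, L i (n%:R *: z + v) = 0); last first.
    by near=> n => e; apply: bad; exists n.
  near=> n => e; have : (n1 < n)%N by near: n; exact: nbhs_infty_gt.
  move: e e1; rewrite !affine// => e e1 ltn.
  have : (n%:R - n1%:R) *: L i z = 0.
    rewrite scalerBl -(addrK (L i v) (n%:R *: L i z)) e.
    by rewrite -(addrK (L i v) (n1%:R *: L i z)) e1 subrr.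
  move/eqP; rewrite scaler_eq0 subr_eq0 eqr_nat gtn_eqF//= => /eqP z00.
  by case: zv => //; move: e; rewrite z00 scaler0 add0r.
have eventually_all : \forall n \near \oo,
    forall i, i \in i0 :: s -> L i (n%:R *: z + v) <> 0.
  have all_near (r : seq I) : {subset r <= i0 :: s} -> \forall n \near \oo,
      forall i, i \in r -> L i (n%:R *: z + v) <> 0.
    elim: r => [|i r IHr] rs; first by near=> n.
    have ri : i \in i0 :: s by apply: rs; rewrite mem_head.
    have nearr : \forall n \near \oo, forall j, j \in r -> L j (n%:R *: z + v) <> 0.
      by apply: IHr => j jr; apply: rs; rewrite in_cons jr orbT.
    have neari : \forall n \near \oo, L i (n%:R *: z + v) <> 0.
      apply: line_nonzero => //; move: ri; rewrite in_cons => /predU1P[->|/vP].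
        by left.
      by right.
    near=> n => j; rewrite in_cons => /predU1P[->|]; first by near: n.
    by move: j; near: n.
  exact: all_near.
near \oo => n; exists (n%:R *: z + v); near: n; exact: eventually_all.
Unshelve. all: by end_near. Qed.

Section Separation.
Context (R : realType) (k : scalar_kind).
Context (H : completeNormedModType (scalars R k)) (dot : inner_product H).

Lemma common_nonzero_dot (s : seq H) : (forall u, u \in s -> u <> 0) ->
  exists x, forall u, u \in s -> dot x u <> 0.
Proof.
move=> s0.
have [u us|u us|x xP] :=
    @common_nonzero (scalars R k) H (scalars R k)^o _ s (fun u x => dot x u).
- by move=> a x y /=; rewrite linearPl.
- exists u => duu; have /eqP/(neq0_dnorm_gt0 (s := dot)) := s0 _ us.
  by rewrite duu ltxx.
by exists x.
Qed.

(** First y is chosen so that the differing operators still differ at y, and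
    then x so that the scalar product with x sees these finitely many nonzero
    vectors. *)
Lemma separating_vectors (A : nat -> H -> H) (s : seq (nat * nat)) :
  (forall j, linear (A j)) ->
  exists xy : H * H, forall ij, ij \in s ->
    dot xy.1 (A ij.1 xy.2) = dot xy.1 (A ij.2 xy.2) -> A ij.1 = A ij.2.
Proof.
move=> linA.
pose r := [seq ij <- s | `[< A ij.1 <> A ij.2 >]].
have [[i j] _|[i j]|y yP] :=
    @common_nonzero (scalars R k) H H _ r (fun ij v => A ij.1 v - A ij.2 v).
- by move=> a u v /=; rewrite !linA scalerBr addrACA opprD.
- rewrite mem_filter => /andP[/asboolP /= neq _]; apply: contrapT => all0.
  apply: neq; apply/funext => v; apply/eqP; rewrite -subr_eq0; apply/eqP.
  by apply: contrapT => nz; apply: all0; exists v.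
have [u /mapP[ij /yP nz ->]//|x xP] :=
  common_nonzero_dot (s := [seq A ij.1 y - A ij.2 y | ij <- r]).
exists (x, y) => ij ijs /= e; apply: contrapT => neq.
have ijr : ij \in r by rewrite mem_filter ijs andbT; apply/asboolP.
have := xP _ (map_f (fun ij => A ij.1 y - A ij.2 y) ijr).
by rewrite linearBr /= e subrr.
Qed.

Lemma measurable_scalar_set1 (c : scalars R k) :
  measurable ([set c] : set (borel_scalars R k)).
Proof.
rewrite -(setCK [set c]); apply: measurableC; apply: sub_sigma_algebra.
apply: closed_openC; apply: accessible_closed_set1; apply: hausdorff_accessible.
exact: norm_hausdorff.
Qed.

End Separation.

(** * Mean contraction of random compositions *)

Section Majorants.
Import HBNNSimple.

(** The integral of a nonnegative function f is a supremum over the simple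
    functions below f, each of which is below g almost everywhere; this is why
    f may be nonmeasurable. *)
Lemma integral_le_ae_majorant (d : measure_display) (T : measurableType d)
    (R : realType) (mu : {measure set T -> \bar R}) (N : set T)
    (f g : T -> \bar R) :
  measurable N -> mu N = 0%E -> measurable_fun setT g ->
  (forall w, (0 <= f w)%E) -> (forall w, (0 <= g w)%E) ->
  (forall w, ~ N w -> (f w <= g w)%E) ->
  (\int[mu]_w f w <= \int[mu]_w g w)%E.
Proof.
move=> mN muN mg f0 g0 fg.
rewrite (ge0_integralTE mu f0); apply: ge_ereal_sup => _ [h /= hf <-].
rewrite -(integralT_nnsfun mu h).
apply: ae_ge0_le_integral => //; first by move=> w _; rewrite lee_fin.
  exact/measurable_EFinP.
exists N; split => // w /= nle; apply: contrapT => Nw; apply: nle => _.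
exact: le_trans (hf w) (fg _ Nw).
Qed.

End Majorants.

Section RandomComposition.
Context (H : Type) (Omega : Type).

(** The recursion peels off the map applied first: once the outcomes up to time
    n are known, the vector on which the later maps act is deterministic, as
    the induction of [le_energy_majorant] requires. *)
Fixpoint composed (Z : nat -> Omega -> H -> H) (w : Omega) (n m : nat) (v : H) : H :=
  if m is m'.+1 then composed Z w n.+1 m' (Z n w v) else v.

Lemma composedSr Z w n m v :
  composed Z w n m.+1 v = Z (n + m)%N w (composed Z w n m v).
Proof.
elim: m n v => [|m IH] n v; first by rewrite addn0.
by apply: etrans (IH n.+1 (Z n w v)) _; rewrite addSnnS.
Qed.

End RandomComposition.

Section MeanContraction.
Context (R : realType) (d : measure_display) (Omega : measurableType d).
Context (Pr : probability Omega R) (H : Type).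
Variables (q : nat -> R) (D : nat -> H -> H) (e : H -> R) (r : R).
Hypothesis q_ge0 : forall j, 0 <= q j.
Hypothesis e_ge0 : forall v, 0 <= e v.
Hypothesis r_ge0 : 0 <= r.
Hypothesis contraction :
  forall v, (\sum_(j <oo) (q j * e (D j v))%:E <= (r * e v)%:E)%E.

Variables (F : nat -> nat -> set Omega) (Z : nat -> Omega -> H -> H).
Hypothesis mF : forall n j, measurable (F n j).

Definition history (s : seq nat) : set Omega :=
  \bigcap_(i in [set` iota 0 (size s)]) F i (nth 0%N s i).

Hypothesis history_le :
  forall s, (Pr (history s) <= (\prod_(j <- s) q j)%:E)%E.

Variable N : set Omega.
Hypotheses (mN : measurable N) (PrN : Pr N = 0%E).
Hypothesis coverF :
  forall w, ~ N w -> forall n, exists2 j, F n j w & Z n w = D j.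

(** The sum, over all continuations of s by m indices, of e along the
    continuation started at v times the indicator of its event. For a given
    continuation the vector is no longer random, which makes this function
    measurable. *)
Fixpoint energy_majorant (m : nat) (s : seq nat) (v : H) (w : Omega) : \bar R :=
  if m is m'.+1 then
    (\sum_(0 <= j <oo) energy_majorant m' (rcons s j) (D j v) w)%E
  else (e v * \1_(history s) w)%:E.

Lemma measurable_history s : measurable (history s).
Proof.
rewrite /history bigcap_seq.
by apply: big_ind => [|A B mA mB|i _]; [exact: measurableT|exact: measurableI|].
Qed.

Lemma energy_majorant_ge0 m s v w : (0 <= energy_majorant m s v w)%E.
Proof.
elim: m s v => [|m IH] s v /=; first by rewrite lee_fin mulr_ge0.
by apply: nneseries_ge0.
Qed.

Lemma measurable_energy_majorant m s v :
  measurable_fun setT (energy_majorant m s v).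
Proof.
elim: m s v => [|m IH] s v /=.
  apply/measurable_EFinP; apply: measurable_funM => //.
  by apply: measurable_indic; exact: measurable_history.
apply: (ge0_emeasurable_sum (P := xpredT)) => [j w _ _|j _].
  exact: energy_majorant_ge0.
exact: IH.
Qed.

(** For each index j following s, the induction bounds the integral in terms of
    the fixed vector D_j v, and [contraction] sums these bounds over j. Upper
    bounds on the probabilities of the histories suffice, since all terms are
    nonnegative. *)
Lemma integral_energy_majorant m s v :
  (\int[Pr]_w energy_majorant m s v w <=
    ((\prod_(j <- s) q j) * (r ^+ m * e v))%:E)%E.
Proof.
elim: m s v => [|m IH] s v /=.
  under eq_integral do rewrite EFinM.
  rewrite ge0_integralZl//; last 2 first.
  - by apply/measurable_EFinP; apply: measurable_indic; exact: measurable_history.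
  - by rewrite lee_fin.
  rewrite integral_indic//; last exact: measurable_history.
  rewrite setIT expr0 mul1r mulrC EFinM.
  by apply: lee_wpmul2l (history_le s); rewrite lee_fin.
rewrite integral_nneseries//; last 2 first.
- by move=> j; exact: measurable_energy_majorant.
- by move=> j w _; exact: energy_majorant_ge0.
have Q0 : 0 <= \prod_(j <- s) q j by rewrite prodr_ge0.
apply: (@le_trans _ _
    (\sum_(j <oo) ((\prod_(j <- s) q j) * r ^+ m)%:E * (q j * e (D j v))%:E)%E).
  apply: lee_nneseries => [j _ _|j _].
    by apply: integral_ge0 => w _; exact: energy_majorant_ge0.
  apply: le_trans (IH _ _) _; rewrite -EFinM lee_fin big_rcons/=.
  lra.
rewrite nneseriesZl; last by move=> j _; rewrite lee_fin mulr_ge0.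
apply: (@le_trans _ _ (((\prod_(j <- s) q j) * r ^+ m)%:E * (r * e v)%:E)%E).
  by apply: lee_wpmul2l => //; rewrite lee_fin mulr_ge0// exprn_ge0.
by rewrite -EFinM lee_fin exprS; lra.
Qed.

Lemma history_rcons s j w :
  history s w -> F (size s) j w -> history (rcons s j) w.
Proof.
move=> hs Fj i /=; rewrite mem_iota add0n size_rcons ltnS nth_rcons => /andP[_].
rewrite leq_eqVlt => /predU1P[->|ltis]; first by rewrite ltnn eqxx.
by rewrite ltis; apply: hs; rewrite /= mem_iota.
Qed.

(** Off N the realised indices give one term of the sum, and that term alone
    is the left-hand side. *)
Lemma le_energy_majorant m s v w : ~ N w -> history s w ->
  ((e (composed Z w (size s) m v))%:E <= energy_majorant m s v w)%E.
Proof.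
move=> Nw; elim: m s v => [|m IH] s v hs /=.
  by rewrite indicE mem_set// mulr1.
have [j Fj ->] := coverF Nw (size s).
rewrite (@nneseriesD1 _ _ j)//; last first.
  by move=> l _; exact: energy_majorant_ge0.
rewrite -(size_rcons s j); apply: le_trans (IH _ _ (history_rcons hs Fj)) _.
by rewrite leeDl// nneseries_ge0// => l _ _; exact: energy_majorant_ge0.
Qed.

Lemma mean_energy_composed n v :
  (\int[Pr]_w (e (composed Z w 0 n v))%:E <= (r ^+ n * e v)%:E)%E.
Proof.
apply: (@le_trans _ _ (\int[Pr]_w energy_majorant n [::] v w)%E).
  apply: (integral_le_ae_majorant mN PrN).
  - exact: measurable_energy_majorant.
  - by move=> w; rewrite lee_fin.
  - by move=> w; exact: energy_majorant_ge0.
  - by move=> w Nw; apply: (@le_energy_majorant n [::] v w Nw).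
by apply: le_trans (integral_energy_majorant _ _ _) _; rewrite big_nil mul1r.
Qed.

End MeanContraction.

(** The function f o eta is constant on each atom but arbitrary, and possibly
    nonmeasurable, on the null set outside the atoms; hence the passage through
    a measurable majorant. *)
Lemma mean_le_weights (R : realType) (d : measure_display)
    (Omega : measurableType d) (Pr : probability Omega R) (V : Type)
    (A : nat -> V) (p : nat -> R) (eta : Omega -> V) (f : V -> R) :
  (forall j, 0 <= p j) -> (\sum_(0 <= j <oo) (p j)%:E = 1)%E ->
  (forall j, measurable (eta @^-1` [set A j]) /\
    Pr (eta @^-1` [set A j]) =
      (\sum_(0 <= i <oo | `[< A i = A j >]) (p i)%:E)%E) ->
  (forall v, 0 <= f v) ->
  (\int[Pr]_w (f (eta w))%:E <=
    \sum_(0 <= j <oo) (fine (weight A p j) * f (A j))%:E)%E.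
Proof.
move=> p0 psum law f0.
pose g j w : \bar R := ((f (A j))%:E * (\1_(atom A eta j) w)%:E)%E.
have mat := measurable_atom law.
have g0 j w : (0 <= g j w)%E by rewrite /g -EFinM lee_fin mulr_ge0.
have mi j : measurable_fun [set: Omega] (fun w => (\1_(atom A eta j) w)%:E : \bar R).
  by apply/measurable_EFinP; exact: measurable_indic.
have mg j : measurable_fun [set: Omega] (g j).
  by apply: emeasurable_funM => //; exact: measurable_cst.
rewrite [leRHS](_ : _ = \int[Pr]_w (\sum_(0 <= j <oo) g j w))%E; last first.
  rewrite integral_nneseries//; apply: eq_eseriesr => j _.
  rewrite ge0_integralZl// ?lee_fin// integral_indic// setIT EFinM.
  by rewrite (atom_fineK law) muleC.
apply: (integral_le_ae_majorant _ (atoms_ae p0 psum law)).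
- by apply: measurableC; apply: bigcup_measurable.
- by apply: (ge0_emeasurable_sum (P := xpredT)).
- by move=> w; rewrite lee_fin.
- by move=> w; apply: nneseries_ge0.
move=> w /contrapT[j _ [lj ej]].
rewrite (@nneseriesD1 _ _ j)//= {1}/g indicE mem_set// mule1 ej leeDl//.
exact: nneseries_ge0.
Qed.

(** * Orthogonal projections and the real norm *)

Section HilbertGeometry.
Context (R : realType) (k : scalar_kind).

Lemma re_scalarD (a b : scalars R k) :
  re_scalar (a + b) = re_scalar a + re_scalar b.
Proof. by case: k a b => //= -[a1 a2] [b1 b2]. Qed.

Lemma re_scalar_sqr (a : scalars R k) : 0 <= a ->
  re_scalar (a ^+ 2) = re_scalar a ^+ 2.
Proof.
case: k a => //= -[a b]; rewrite lecE /= => /andP[/eqP b0 _].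
by rewrite b0 !expr2 /= mulr0 subr0.
Qed.

Context (H : completeNormedModType (scalars R k)) (dot : inner_product H).
Hypothesis hdot : induces_norm dot.

Lemma real_norm_sqrE (x : H) : real_norm x ^+ 2 = re_scalar (dot x x).
Proof. by rewrite -hdot re_scalar_sqr. Qed.

Lemma projection_pythagoras (Q : H -> H) (v : H) :
  selfadjoint_projection dot Q ->
  real_norm (v - Q v) ^+ 2 + real_norm (Q v) ^+ 2 = real_norm v ^+ 2.
Proof.
move=> [[linQ _] adjQ /(congr1 (fun f => f v)) /= QQ].
have QB a b : Q (a - b) = Q a - Q b.
  by rewrite addrC -scaleN1r linQ scaleN1r addrC.
rewrite !real_norm_sqrE -re_scalarD; congr re_scalar.
rewrite linearBl/= !linearBr/= (adjQ v v) (adjQ v (Q v)) QQ.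
by rewrite subrr subr0 subrK.
Qed.

End HilbertGeometry.

(** * Joint law of independent discrete operators *)

Section IndependentProjections.
Context (R : realType) (k : scalar_kind).
Context (H : completeNormedModType (scalars R k)) (dot : inner_product H).
Context (d : measure_display) (Omega : measurableType d).
Context (Pr : probability Omega R).
Variables (P : nat -> H -> H) (p : nat -> R) (eta : nat -> Omega -> H -> H).
Hypothesis linP : forall j, linear (P j).
Hypothesis p_ge0 : forall j, 0 <= p j.
Hypothesis p_sum : (\sum_(0 <= j <oo) (p j)%:E = 1)%E.
Hypothesis eta_rv : forall n, operator_random_variable dot (eta n).
Hypothesis eta_indep : operators_independent dot Pr eta.
Hypothesis eta_law : forall n, discrete_distribution Pr P p (eta n).

Local Notation q := (fun j => fine (weight P p j)).

(** For each N, vectors x and y that separate the operators in s from the first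
    N ones turn the independence of the scalars <x, eta_n y> into a bound whose
    factors exceed the weights by the mass beyond N; then N tends to infinity. *)
Lemma history_prob_le s :
  (Pr (history (fun n => atom P (eta n)) s) <= (\prod_(j <- s) q j)%:E)%E.
Proof.
set E := history _ s.
have q0 j : 0 <= q j.
  rewrite fine_ge0// /weight; case: ifP => // _.
  by apply: nneseries_ge0 => i _ _; rewrite lee_fin.
have [lead|nlead] := pselect (forall j, j \in s -> leading P j); last first.
  (* atoms at non-leading indices are empty *)
  rewrite (_ : E = set0) ?measure0 ?lee_fin ?prodr_ge0//.
  apply/seteqP; split=> // w Ew; apply: nlead => j js.
  have [|+ _] := Ew (index j s); last by rewrite nth_index.
  by rewrite /= mem_iota/= add0n index_mem.
pose tail N := 1 - \sum_(l < N) q l.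
have mE : measurable E.
  by apply: measurable_history => n j; exact: (measurable_atom (eta_law n)).
have bound N : (Pr E <= (\prod_(j <- s) (q j + tail N))%:E)%E.
  pose pairs := [seq (i, j) | i <- iota 0 N, j <- s].
  have [[x y] /= sep] := separating_vectors dot pairs linP.
  pose X n w := dot x (eta n w y); pose c j := dot x (P j y).
  have mX n j : measurable (X n @^-1` [set c j]).
    rewrite -[X in measurable X]setTI; have [_ mXn] := eta_rv n.
    by apply: (mXn x y measurableT); exact: measurable_scalar_set1.
  have XE : Pr (\bigcap_(i in [set` iota 0 (size s)]) (X i @^-1` [set c (nth 0%N s i)]))
      = (\prod_(i <- iota 0 (size s)) Pr (X i @^-1` [set c (nth 0%N s i)]))%E.
    apply: (eta_indep x y (B := fun i => [set c (nth 0%N s i)])).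
      exact: iota_uniq.
    by move=> i; exact: measurable_scalar_set1.
  apply: (@le_trans _ _ (Pr (\bigcap_(i in [set` iota 0 (size s)])
      (X i @^-1` [set c (nth 0%N s i)])))).
    apply: le_measure; rewrite ?inE//.
      rewrite bigcap_seq; apply: big_ind => [|A B mA mB|i _] //.
      exact: measurableI.
    by move=> w Ew i si; have [_ e] := Ew i si; rewrite /= /X e.
  rewrite XE (big_nth 0%N) /index_iota subn0.
  have fX i : Pr (X i @^-1` [set c (nth 0%N s i)]) =
      (fine (Pr (X i @^-1` [set c (nth 0%N s i)])))%:E.
    by rewrite fineK// fin_num_measure.
  rewrite (eq_bigr _ (fun i _ => fX i)) prodEFin lee_fin.
  rewrite big_seq_cond [leRHS]big_seq_cond.
  apply: ler_prod => i; rewrite mem_iota add0n andbT => /= ilts.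
  rewrite fine_ge0//= -lee_fin -fX.
  apply: (label_fiber_le (eta_law i)) => //.
  - by move=> w l e; rewrite /X e.
  - move=> l lN ccl; apply: (sep (l, nth 0%N s i)) => //.
    by apply/allpairsP; exists (l, nth 0%N s i); rewrite mem_iota add0n mem_nth.
  - by apply: lead; rewrite mem_nth.
have tail0 : tail N @[N --> \oo] --> 0.
  rewrite -[X in _ --> X](subrr 1); apply: cvgB; first exact: cvg_cst.
  exact: weight_partial_cvg.
have lim_prod : (\prod_(j <- s) (q j + tail N)) @[N --> \oo] --> \prod_(j <- s) q j.
  apply: cvg_big => [|j _]; first exact: mul_continuous.
  by rewrite -[X in _ --> X]addr0; apply: cvgD => //; exact: cvg_cst.
have EK : (fine (Pr E))%:E = Pr E by rewrite fineK// fin_num_measure.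
rewrite -EK lee_fin -(cvg_lim _ lim_prod)//.
apply: limr_ge; first by apply/cvg_ex; exists (\prod_(j <- s) q j).
by near=> N; rewrite -lee_fin EK.
Unshelve. all: by end_near. Qed.

End IndependentProjections.

(** * Decay of the mean energy *)

Theorem theorem3p20
  (R : realType) (k : scalar_kind)
  (H : completeNormedModType (scalars R k))
  (dot : inner_product H) (hdot : induces_norm dot)
  (P : nat -> H -> H)
  (hP : forall j, selfadjoint_projection dot (P j))
  (d : measure_display) (Omega : measurableType d) (Pr : probability Omega R)
  (xi : Omega -> H -> H) (hxi : operator_random_variable dot xi)
  (p : nat -> R) (hp : forall j, 0 < p j)
  (hsum : (\sum_(0 <= j <oo) (p j)%:E = 1)%E)
  (hlaw : discrete_distribution Pr P p xi)
  (C : R) (hC : 0 < C < 1)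
  (hbound : forall x : H,
    ((C * real_norm x ^+ 2)%R%:E <= 'E_Pr[fun w => (real_norm (xi w x) ^+ 2)%R])%E)
  (xis : nat -> Omega -> H -> H)
  (hxis0 : forall w, xis 0%N w = P 0%N)
  (hxis : forall n, operator_random_variable dot (xis n.+1))
  (hindep : operators_independent dot Pr (fun n => xis n.+1))
  (hident : forall n, discrete_distribution Pr P p (xis n.+1)) :
  forall x : H,
    ('E_Pr[fun w => (real_norm (residual (fun j => xis j w) n x) ^+ 2)%R])%E
      @[n --> \oo] --> 0%E.
Proof.
have p0 j : 0 <= p j by exact: ltW.
have linP j : linear (P j) by have [[]] := hP j.
pose q j := fine (weight P p j).
pose e (v : H) := real_norm v ^+ 2.
have e0 v : 0 <= e v by exact: sqr_ge0.
have w0 j : (0 <= weight P p j)%E by rewrite -(atom_weight hlaw).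
have q0 j : 0 <= q j by rewrite fine_ge0.
have qE j : (q j)%:E = weight P p j by rewrite /q (atom_fineK hlaw) (atom_weight hlaw).
have r0 : 0 <= 1 - C by lra.
have contraction v :
    (\sum_(0 <= j <oo) (q j * e (v - P j v))%:E <= ((1 - C) * e v)%:E)%E.
  have lower : ((C * e v)%:E <= \sum_(0 <= j <oo) (q j * e (P j v))%:E)%E.
    apply: le_trans (hbound v) _; rewrite unlock.
    exact: (mean_le_weights (f := fun A => e (A v)) p0 hsum hlaw).
  have split : (\sum_(0 <= j <oo) (q j * e (v - P j v))%:E +
      \sum_(0 <= j <oo) (q j * e (P j v))%:E = (e v)%:E)%E.
    rewrite -nneseriesD; try by move=> j _ _; rewrite lee_fin mulr_ge0.
    transitivity (\sum_(0 <= j <oo) (e v)%:E * weight P p j)%E.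
      apply: eq_eseriesr => j _; rewrite -qE -EFinD -mulrDr /e.
      by rewrite (projection_pythagoras hdot)// mulrC EFinM.
    by rewrite nneseriesZl// weight_sum// hsum mule1.
  rewrite mulrBl mul1r EFinB leeBrDr// -split.
  exact: leeD2l.
pose Z n w v := v - xis n.+1 w v.
pose N := \bigcup_n ~` \bigcup_j atom P (xis n.+1) j.
have mN n : measurable (~` \bigcup_j atom P (xis n.+1) j).
  apply: measurableC; apply: bigcup_measurable => j _.
  exact: (measurable_atom (hident n)).
have PrN : Pr N = 0%E.
  apply/eqP; rewrite eq_le measure_ge0 andbT.
  have mNN : measurable N by apply: bigcup_measurable.
  have subN : N `<=` \bigcup_n ~` \bigcup_j atom P (xis n.+1) j by [].
  apply: le_trans (measure_sigma_subadditive Pr mN mNN subN) _.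
  by rewrite eseries0// => n _ _; exact: (atoms_ae p0 hsum (hident n)).
have decay n v : (\int[Pr]_w (e (composed Z w 0 n v))%:E <= ((1 - C) ^+ n * e v)%:E)%E.
  apply: (@mean_energy_composed _ _ _ Pr _ q (fun j v => v - P j v) e _ q0 e0 r0
    contraction (fun n => atom P (xis n.+1)) Z _ _ N _ PrN).
  - by move=> m j; exact: (measurable_atom (hident m)).
  - exact: (history_prob_le linP p0 hsum hxis hindep hident).
  - exact: bigcup_measurable.
  move=> w Nw m; have [j _ aj] : (\bigcup_j atom P (xis m.+1) j) w.
    by apply: contrapT => nw; apply: Nw; exists m.
  by exists j => //; rewrite /Z; case: aj => _ ->.
move=> x; set v := x - P 0%N x.
have residualE w n : residual (fun j => xis j w) n x = composed Z w 0 n v.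
  elim: n => [|n IH]; first by rewrite /= hxis0.
  by rewrite composedSr -IH.
apply: (@squeeze_cvge _ _ _ _ (fun=> 0%E) _ (fun n => ((1 - C) ^+ n * e v)%:E)).
- near=> n; rewrite unlock; apply/andP; split.
    by apply: integral_ge0 => w _; rewrite lee_fin sqr_ge0.
  by under eq_integral do rewrite residualE; exact: decay.
- exact: cvg_cst.
apply: cvg_EFin; first by near=> n.
rewrite -(mul0r (e v)); apply: cvgMl; apply: cvg_expr.
by rewrite ger0_norm//; lra.
Unshelve. all: by end_near. Qed.
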